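(* Let $\mathcal{M}:(0,\infty)\to(0,\infty)$ be the Mina margin map. Then: (1) $\mathcal{M}(s(x))=\mathcal{M}(x)$ for all $x\in(0,\infty)$; (2) $\mathcal{M}$ is continuous on $(0,\infty)$ and $\mathcal{M}(x)=\Big(\sum_{k\in\mathbb{Z}}\prod_{i=0}^k(c_i(x)-1)\Big)^{-1}\cdot x\sum_{k\in\mathbb{Z}}\prod_{i=0}^k(d_i(x)-1)$; (3) $\mathcal{M}((0,\infty))=[\lambda,\lambda^{-1}]$ for some $\lambda\in(0,0.999904]$ (this $\lambda$ is the infimum of Mina margins of positive ABMN solutions).
   Context: ABMN system on $\mathbb{Z}$: real variables $a_i,b_i\ge0$, $m_i,n_i$ with, for all $i$, $(a_i+b_i)(m_i+a_i)=a_im_{i+1}+b_im_{i-1}$, $(a_i+b_i)(n_i+b_i)=a_in_{i+1}+b_in_{i-1}$, $(a_i+b_i)^2=b_i(m_{i+1}-m_{i-1})$, $(a_i+b_i)^2=a_i(n_{i-1}-n_{i+1})$; positive if all $a_i,b_i>0$; $m_{\pm\infty},n_{\pm\infty}$ are the (real) limits as $i\to\pm\infty$; the Mina margin is $\frac{n_{-\infty}-n_\infty}{m_\infty-m_{-\infty}}$; the central ratio is $\frac{n_{-1}-n_0}{m_0-m_{-1}}$. A positive solution is standard if $m_{-\infty}=0$, $n_\infty=0$, $m_\infty=1$; for each $x>0$ there is exactly one standard solution $(a^{\rm st}(x),b^{\rm st}(x),m^{\rm st}(x),n^{\rm st}(x))$ with central ratio $x$. The Mina margin map is $\mathcal{M}(x)=n^{\rm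 st}_{-\infty}(x)$, the Mina margin of that solution. Functions: for $x>0$, $\omega=\sqrt{8x+1}$, $c(x)=\frac{(\omega+3)^2}{16}$, $d(x)=\frac{(\omega+3)^2}{8(\omega+1)}$, $s(x)=\frac{(\omega-1)^2}{4(\omega+7)}$; $s_{-1}(x)=1/s(1/x)$, $s_0(x)=x$, $s_i=s\circ s_{i-1}$, $s_{-i}=s_{-1}\circ s_{-(i-1)}$ ($i\in\mathbb{N}_+$); $c_j=c\circ s_j$, $d_j=d\circ s_j$. Product convention: $\prod_{i=0}^k h_i=h_0\cdots h_k$ for $k\ge0$, $=1$ for $k=-1$, $=h_{k+1}^{-1}\cdots h_{-1}^{-1}$ for $k\le-2$. *)

(* Defs.v *)
From Stdlib Require Import Reals ZArith ClassicalEpsilon.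
Open Scope R_scope.

Definition ABMN (a b m n : Z -> R) : Prop :=
  forall i : Z,
    0 <= a i /\ 0 <= b i /\
    (a i + b i) * (m i + a i) = a i * m (i + 1)%Z + b i * m (i - 1)%Z /\
    (a i + b i) * (n i + b i) = a i * n (i + 1)%Z + b i * n (i - 1)%Z /\
    (a i + b i) ^ 2 = b i * (m (i + 1)%Z - m (i - 1)%Z) /\
    (a i + b i) ^ 2 = a i * (n (i - 1)%Z - n (i + 1)%Z).

Definition positive_ABMN (a b m n : Z -> R) : Prop :=
  ABMN a b m n /\ forall i : Z, 0 < a i /\ 0 < b i.

Definition lim_pinf (u : Z -> R) (l : R) : Prop :=
  Un_cv (fun k : nat => u (Z.of_nat k)) l.
Definition lim_minf (u : Z -> R) (l : R) : Prop :=
  Un_cv (fun k : nat => u (- Z.of_nat k)%Z) l.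

Definition mina_margin (mmi mpi nmi npi : R) : R := (nmi - npi) / (mpi - mmi).

Definition central_ratio (m n : Z -> R) : R :=
  (n (-1)%Z - n 0%Z) / (m 0%Z - m (-1)%Z).

Definition standard (a b m n : Z -> R) : Prop :=
  positive_ABMN a b m n /\ lim_minf m 0 /\ lim_pinf n 0 /\ lim_pinf m 1 /\
  exists l, lim_minf n l.

(* Mina margin map: n_{-oo} of the (unique) standard solution with central ratio x
   (its Mina margin equals n_{-oo}). *)
Definition MinaMap (x : R) : R :=
  epsilon (inhabits 0) (fun y => exists a b m n,
    standard a b m n /\ central_ratio m n = x /\ lim_minf n y).

Definition omega (x : R) : R := sqrt (8 * x + 1).
Definition cfun (x : R) : R := (omega x + 3) ^ 2 / 16.
Definition dfun (x : R) : R := (omega x + 3) ^ 2 / (8 * (omega x + 1)).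
Definition sfun (x : R) : R := (omega x - 1) ^ 2 / (4 * (omega x + 7)).
Definition sm1 (x : R) : R := / sfun (/ x).

Definition s_Z (j : Z) (x : R) : R :=
  match j with
  | Z0 => x
  | Zpos p => Nat.iter (Pos.to_nat p) sfun x
  | Zneg p => Nat.iter (Pos.to_nat p) sm1 x
  end.

Definition c_Z (j : Z) (x : R) : R := cfun (s_Z j x).
Definition d_Z (j : Z) (x : R) : R := dfun (s_Z j x).

Fixpoint prodn (f : nat -> R) (n : nat) : R :=
  match n with
  | O => 1
  | S k => prodn f k * f k
  end.

(* \prod_{i=0}^k h_i with the paper's convention for k <= -1 *)
Definition zprod (h : Z -> R) (k : Z) : R :=
  if Z.leb 0 k then prodn (fun i => h (Z.of_nat i)) (S (Z.to_nat k))
  else prodn (fun j => / h (- Z.of_nat j - 1)%Z) (Z.to_nat (- k - 1)).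

Definition zsum (f : Z -> R) (l : R) : Prop :=
  exists l1 l2,
    infinite_sum (fun k : nat => f (Z.of_nat k)) l1 /\
    infinite_sum (fun k : nat => f (- Z.of_nat k - 1)%Z) l2 /\
    l = l1 + l2.

Definition is_inf (S : R -> Prop) (l : R) : Prop :=
  (forall y, S y -> l <= y) /\ (forall l', (forall y, S y -> l' <= y) -> l' <= l).

Definition margins_of_positive : R -> Prop := fun r =>
  exists a b m n mmi mpi nmi npi,
    positive_ABMN a b m n /\ lim_minf m mmi /\ lim_pinf m mpi /\
    lim_minf n nmi /\ lim_pinf n npi /\ r = mina_margin mmi mpi nmi npi.

(* Main.v *)
Require Import Defs.
From Stdlib Require Import Reals ZArith List ClassicalEpsilon Lra Lia.
From Coquelicot Require Import Coquelicot.
Import ListNotations.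
Open Scope R_scope.

(** Put [u_i = m_i - m_(i-1)] and [v_i = n_(i-1) - n_i]. For positive [a_i], [b_i] the
    four ABMN equations at [i] say exactly that [u_i = a_i^2 / b_i],
    [v_i = a_i + 2 b_i], [u_(i+1) = 2 a_i + b_i] and [v_(i+1) = b_i^2 / a_i]. Hence, with
    [t = b_i / a_i], the ratio [x_i = v_i / u_i] equals [t (1 + 2 t)], which determines
    [t], and passing to [i + 1] maps [x_i] to [s(x_i)] and multiplies [u], [v] by
    [c(x_i) - 1], [d(x_i) - 1]. The margin is therefore a quotient of two bilateral
    series along the [s]-orbit of the central ratio.

    The reflection [i -> -1 - i], exchanging [a, b] and [m, n], inverts the central ratio
    and the margin. It turns the half of each series at [-oo] into a half at [+oo], where
    convergence is locally uniform because [s(x) <= x / 9]. The partial sums of the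
    series, divided by the total of the [u_i], are functions of [x_i] alone, and give the
    standard solution in closed form. Invariance under [s] and inversion reduces every
    margin to a central ratio between [1/10 = s(1)] and [10], so a least margin [lam]
    exists and [/ lam] is the greatest; a numerical evaluation near the minimiser
    bounds [lam]. *)

Definition continuous_pos (f : R -> R) : Prop := forall x, 0 < x -> continuity_pt f x.
Definition increasing_pos (f : R -> R) : Prop := forall x y, 0 < x <= y -> f x <= f y.

Lemma prodn_ext f g n : (forall i, f i = g i) -> prodn f n = prodn g n.
Proof. intros H; induction n as [|n IH]; simpl; [easy|now rewrite IH, H]. Qed.

Lemma prodn_succ_l f n : prodn f (S n) = f 0%nat * prodn (fun i => f (S i)) n.
Proof.
  induction n as [|n IH]; [simpl; ring|].
  change (prodn f (S (S n))) with (prodn f (S n) * f (S n)); rewrite IH; simpl; ring.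
Qed.

Lemma prodn_pos_le f g n :
  (forall i, 0 < f i <= g i) -> 0 < prodn f n <= prodn g n.
Proof.
  intros H; induction n as [|n IH]; simpl; [lra|]; specialize (H n); split.
  - now apply Rmult_lt_0_compat.
  - apply Rmult_le_compat; lra.
Qed.

Lemma ex_series_prodn_geom A q :
  0 < A -> 0 < q < 1 -> ex_series (fun k => prodn (fun i => A * q ^ i) (S k)).
Proof.
  intros HA Hq; set (M := fun k => prodn (fun i => A * q ^ i) (S k)).
  assert (HM : forall k, 0 < M k).
  { intros k; apply (prodn_pos_le _ (fun i => A * q ^ i)); intros i.
    split; [|lra]; apply Rmult_lt_0_compat; [easy|apply pow_lt; lra]. }
  apply ex_series_ext with (fun k => Rabs (M k)).
  { intros k; apply Rabs_pos_eq, Rlt_le, HM. }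
  apply ex_series_DAlembert with 0; [lra|intros k; generalize (HM k); lra|].
  apply is_lim_seq_ext with (fun n => A * q * q ^ n).
  - intros n; rewrite Rabs_pos_eq by (apply Rlt_le, Rdiv_lt_0_compat; apply HM).
    change (M (S n)) with (M n * (A * q ^ S n)); simpl.
    field; generalize (HM n); lra.
  - replace (Finite 0) with (Rbar_mult (A * q) 0) by (simpl; f_equal; ring).
    apply is_lim_seq_scal_l, is_lim_seq_geom; rewrite Rabs_pos_eq; lra.
Qed.

Lemma ex_series_Rabs_le (f M : nat -> R) :
  (forall k, Rabs (f k) <= M k) -> ex_series M -> ex_series (fun k => Rabs (f k)).
Proof.
  intros Hf HM; apply (ex_series_le (K := R_AbsRing) (V := R_CompleteNormedModule))
    with (2 := HM); intros k; change (Rabs (Rabs (f k)) <= M k); now rewrite Rabs_Rabsolu.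
Qed.

Lemma Series_remainder_le (f M : nat -> R) n :
  (forall k, Rabs (f k) <= M k) -> ex_series M ->
  Rabs (Series f - sum_f_R0 f n) <= Series M - sum_f_R0 M n.
Proof.
  intros Hf HM; pose proof (ex_series_Rabs_le f M Hf HM) as Hex.
  rewrite (Series_incr_n f (S n)), (Series_incr_n M (S n))
    by (easy || lia || now apply ex_series_Rabs).
  simpl pred; rewrite !Rplus_minus_l.
  apply (ex_series_incr_n (K := R_AbsRing)) with (n := S n) in HM, Hex.
  eapply Rle_trans; [now apply Series_Rabs|]; apply Series_le; [|easy].
  intros k; split; [apply Rabs_pos|easy].
Qed.

Lemma continuity_pt_Series (f : nat -> R -> R) (M : nat -> R) (x : R) (r : posreal) :
  ex_series M -> (forall k y, Boule x r y -> Rabs (f k y) <= M k) ->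
  (forall k y, Boule x r y -> continuity_pt (f k) y) ->
  continuity_pt (fun y => Series (fun k => f k y)) x.
Proof.
  intros HM Hf Hc.
  apply CVU_continuity
    with (fn := fun n y => sum_f_R0 (fun k => f k y) n) (x := x) (r := r).
  - intros eps Heps.
    destruct (proj1 (is_series_Reals _ _) (Series_correct _ HM) eps Heps) as [N HN].
    exists N; intros n y Hn Hy; specialize (HN n Hn).
    rewrite Rdist_sym in HN; apply Rabs_def2 in HN.
    eapply Rle_lt_trans; [|apply HN].
    apply Series_remainder_le; [intros k; now apply Hf|easy].
  - intros n y Hy; apply continuity_pt_finite_SF; intros k _; now apply Hc.
  - unfold Boule; rewrite Rminus_diag, Rabs_R0; apply cond_pos.
Qed.

Definition contracting (s : R -> R) : Prop :=
  exists q, 0 < q < 1 /\ forall x, 0 < x -> 0 < s x <= q * x.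

Lemma contracting_bounds s x : contracting s -> 0 < x -> 0 < s x <= x.
Proof. intros (q & Hq & Hs) Hx; specialize (Hs x Hx); nra. Qed.

Definition weight (h : R -> R) : Prop :=
  (forall x, 0 < x -> 0 < h x) /\
  forall X, 0 < X -> exists C, 0 < C /\ forall x, 0 < x <= X -> h x <= C * x.

(** * Series of products along a contracting orbit *)

Section OrbitSum.

Variables s h : R -> R.

Definition orbit_prod (x : R) (k : nat) : R := prodn (fun i => h (Nat.iter i s x)) k.

(* The empty product is not a summand. *)
Definition orbit_sum (x : R) : R := Series (fun k => orbit_prod x (S k)).

Lemma orbit_prod_succ_l x k : orbit_prod x (S k) = h x * orbit_prod (s x) k.
Proof.
  unfold orbit_prod; rewrite prodn_succ_l; f_equal.
  apply prodn_ext; intros i; now rewrite Nat.iter_succ_r.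
Qed.

Hypothesis s_contracting : contracting s.
Hypothesis h_weight : weight h.

Lemma iter_contracting_pos i x : 0 < x -> 0 < Nat.iter i s x.
Proof.
  apply Nat.iter_invariant; intros y Hy; now apply contracting_bounds.
Qed.

Lemma orbit_prod_majorant X : 0 < X ->
  exists M, ex_series M /\ forall x k, 0 < x <= X -> 0 < orbit_prod x (S k) <= M k.
Proof.
  intros HX; destruct s_contracting as (q & Hq & Hs).
  destruct (proj2 h_weight X HX) as (C & HC & HhC).
  exists (fun k => prodn (fun i => C * X * q ^ i) (S k)); split.
  { apply ex_series_prodn_geom; [now apply Rmult_lt_0_compat|easy]. }
  intros x k Hx; apply prodn_pos_le; intros i.
  assert (Hpos := iter_contracting_pos i x (proj1 Hx)).
  assert (Hiter : Nat.iter i s x <= q ^ i * x).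
  { clear Hpos; induction i as [|i IH]; simpl; [lra|].
    pose proof (Hs _ (iter_contracting_pos i x (proj1 Hx))); nra. }
  assert (Hqi : 0 < q ^ i <= 1).
  { split; [apply pow_lt; lra|rewrite <- (pow1 i); apply pow_incr; lra]. }
  split; [now apply h_weight|].
  assert (q ^ i * x <= q ^ i * X) by (apply Rmult_le_compat_l; lra).
  apply Rle_trans with (C * Nat.iter i s x); [apply HhC; split; nra|].
  rewrite Rmult_assoc; apply Rmult_le_compat_l; lra.
Qed.

Lemma orbit_prod_pos x k : 0 < x -> 0 < orbit_prod x k.
Proof.
  intros Hx; apply (prodn_pos_le _ (fun i => h (Nat.iter i s x))); intros i.
  split; [|lra]; now apply h_weight, iter_contracting_pos.
Qed.

Lemma ex_series_orbit_prod x : 0 < x -> ex_series (fun k => orbit_prod x (S k)).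
Proof.
  intros Hx; destruct (orbit_prod_majorant x Hx) as (M & HM & Hle).
  apply ex_series_Rabs, ex_series_Rabs_le with M; [|easy]; intros k.
  specialize (Hle x k ltac:(lra)); rewrite Rabs_pos_eq; lra.
Qed.

Lemma is_series_orbit_prod x : 0 < x -> is_series (orbit_prod x) (1 + orbit_sum x).
Proof.
  intros Hx; apply is_series_decr_1.
  replace (plus _ _) with (orbit_sum x)
    by (unfold orbit_prod, plus, opp; simpl; ring).
  now apply Series_correct, ex_series_orbit_prod.
Qed.

Lemma orbit_sum_rec x : 0 < x -> orbit_sum x = h x * (1 + orbit_sum (s x)).
Proof.
  intros Hx; pose proof (iter_contracting_pos 1 x Hx) as Hs; simpl in Hs.
  rewrite <- (is_series_unique _ _ (is_series_orbit_prod _ Hs)), <- Series_scal_l.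
  apply Series_ext; intros k; apply orbit_prod_succ_l.
Qed.

Lemma orbit_sum_ge0 x : 0 < x -> 0 <= orbit_sum x.
Proof.
  intros Hx; rewrite <- (Rmult_0_l (orbit_sum x)); unfold orbit_sum.
  rewrite <- Series_scal_l; apply Series_le; [|now apply ex_series_orbit_prod].
  intros k; pose proof (orbit_prod_pos x (S k) Hx); lra.
Qed.

Lemma orbit_sum_continuous_pos :
  continuous_pos s -> continuous_pos h -> continuous_pos orbit_sum.
Proof.
  intros Hs Hh x Hx.
  destruct (orbit_prod_majorant (2 * x) ltac:(lra)) as (M & HM & Hle).
  assert (Hball : forall y, Boule x (mkposreal x Hx) y -> 0 < y <= 2 * x).
  { intros y Hy; unfold Boule in Hy; simpl in Hy; apply Rabs_def2 in Hy; lra. }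
  assert (Hiter : forall i, continuous_pos (Nat.iter i s)).
  { intros i y Hy; induction i as [|i IH]; simpl.
    - apply derivable_continuous_pt, derivable_pt_id.
    - apply (continuity_pt_comp (Nat.iter i s) s); [easy|].
      now apply Hs, iter_contracting_pos. }
  apply continuity_pt_Series with M (mkposreal x Hx); [easy| |].
  - intros k y Hy; specialize (Hle y k (Hball y Hy)); rewrite Rabs_pos_eq; lra.
  - intros k y Hy; apply Hball, proj1 in Hy; unfold orbit_prod; generalize (S k); clear k.
    induction n as [|n IH]; simpl; [now apply continuity_pt_const|].
    apply (continuity_pt_mult (fun z => prodn (fun i => h (Nat.iter i s z)) n)
             (fun z => h (Nat.iter n s z))); [easy|].
    apply (continuity_pt_comp (Nat.iter n s) h); [now apply Hiter|].
    now apply Hh, iter_contracting_pos.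
Qed.

Hypothesis s_increasing : increasing_pos s.
Hypothesis h_increasing : increasing_pos h.

Lemma orbit_sum_increasing_pos : increasing_pos orbit_sum.
Proof.
  intros x y Hxy; apply Series_le; [|apply ex_series_orbit_prod; lra]; intros k.
  assert (Hprod : 0 < orbit_prod x (S k) <= orbit_prod y (S k)); [|lra].
  apply prodn_pos_le; intros i.
  pose proof (iter_contracting_pos i x (proj1 Hxy)) as Hpos.
  split; [now apply h_weight|apply h_increasing; split; [easy|]].
  induction i as [|i IH]; simpl; [easy|].
  assert (0 < Nat.iter i s x) by now apply iter_contracting_pos.
  apply s_increasing; auto.
Qed.

(* By monotonicity the recursion gives [orbit_sum x <= h x * (1 + orbit_sum x)]. *)
Lemma orbit_sum_le_of_supersolution x K :
  0 < x -> 0 <= K -> h x * (1 + K) <= K -> orbit_sum x <= K.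
Proof.
  intros Hx HK Hsuper; pose proof (proj1 h_weight x Hx).
  assert (Hmono : orbit_sum (s x) <= orbit_sum x)
    by now apply orbit_sum_increasing_pos, contracting_bounds.
  assert (orbit_sum x <= h x * (1 + orbit_sum x))
    by (rewrite orbit_sum_rec at 1 by easy; apply Rmult_le_compat_l; lra).
  assert (h x < 1) by nra; nra.
Qed.

End OrbitSum.

Section BilateralSum.

Variable s : R -> R.
Hypothesis s_contracting : contracting s.
Hypothesis s_reversible : forall x, 0 < x -> s (/ s x) = / x.

Definition dual (h h' : R -> R) : Prop := forall x, 0 < x -> h' x * h (/ s x) = 1.

(* [x -> / s x] is an involution. *)
Lemma dual_sym h h' : dual h h' -> dual h' h.
Proof.
  intros Hdual x Hx.
  assert (Hsx : 0 < / s x) by now apply Rinv_0_lt_compat, contracting_bounds.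
  specialize (Hdual _ Hsx); rewrite s_reversible, Rinv_inv in Hdual by easy; lra.
Qed.

Definition bisum (h h' : R -> R) (x : R) : R :=
  orbit_sum s h x + 1 + orbit_sum s h' (/ x).

Lemma bisum_inv h h' x : bisum h h' (/ x) = bisum h' h x.
Proof. unfold bisum; rewrite Rinv_inv; ring. Qed.

Variables h h' : R -> R.
Hypothesis h_weight : weight h.
Hypothesis h'_weight : weight h'.

Lemma bisum_pos x : 0 < x -> 0 < bisum h h' x.
Proof.
  intros Hx; unfold bisum.
  assert (0 <= orbit_sum s h x) by now apply orbit_sum_ge0.
  assert (0 <= orbit_sum s h' (/ x)) by now apply orbit_sum_ge0, Rinv_0_lt_compat.
  lra.
Qed.

Lemma bisum_continuous_pos :
  continuous_pos s -> continuous_pos h -> continuous_pos h' ->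
  continuous_pos (bisum h h').
Proof.
  intros Hs Hh Hh' x Hx.
  apply (continuity_pt_plus (fun y => orbit_sum s h y + 1)
           (fun y => orbit_sum s h' (/ y))).
  - apply (continuity_pt_plus (orbit_sum s h) (fun _ => 1)).
    + now apply orbit_sum_continuous_pos.
    + now apply continuity_pt_const.
  - apply (continuity_pt_comp Rinv (orbit_sum s h')).
    + apply derivable_continuous_pt, ex_derive_Reals_0; auto_derive; lra.
    + now apply orbit_sum_continuous_pos; [..|apply Rinv_0_lt_compat].
Qed.

Hypothesis h_h'_dual : dual h h'.

Lemma orbit_sum_dual_step x : 0 < x ->
  h x * orbit_sum s h' (/ s x) = 1 + orbit_sum s h' (/ x).
Proof.
  intros Hx; rewrite (orbit_sum_rec s h')
    by (easy || now apply Rinv_0_lt_compat, contracting_bounds).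
  rewrite s_reversible, <- Rmult_assoc by easy.
  rewrite (dual_sym _ _ h_h'_dual x Hx); ring.
Qed.

Lemma bisum_step x : 0 < x -> h x * bisum h h' (s x) = bisum h h' x.
Proof.
  intros Hx; unfold bisum; rewrite (orbit_sum_rec s h s_contracting h_weight x Hx).
  rewrite Rmult_plus_distr_l, orbit_sum_dual_step by easy; ring.
Qed.

End BilateralSum.

(** * The maps [s], [c - 1] and [d - 1] *)

Definition cfactor (x : R) : R := cfun x - 1.
Definition dfactor (x : R) : R := dfun x - 1.

(* The ratio [(n_(i-1) - n_i) / (m_i - m_(i-1))] in terms of [t = b_i / a_i]. *)
Definition ratio_of (t : R) : R := t * (1 + 2 * t).
Definition ratio_inv (x : R) : R := (omega x - 1) / 4.

Lemma ratio_of_pos t : 0 < t -> 0 < ratio_of t.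
Proof. unfold ratio_of; nra. Qed.

Lemma omega_ratio_of t : 0 < t -> omega (ratio_of t) = 4 * t + 1.
Proof.
  intros Ht; unfold omega, ratio_of.
  replace (8 * (t * (1 + 2 * t)) + 1) with ((4 * t + 1) ^ 2) by ring.
  apply sqrt_pow2; lra.
Qed.

Lemma ratio_inv_ratio_of t : 0 < t -> ratio_inv (ratio_of t) = t.
Proof. intros Ht; unfold ratio_inv; rewrite omega_ratio_of by easy; field. Qed.

Lemma omega_gt1 x : 0 < x -> 1 < omega x.
Proof. intros Hx; unfold omega; rewrite <- sqrt_1 at 1; apply sqrt_lt_1; lra. Qed.

Lemma ratio_of_surj x : 0 < x -> exists t, 0 < t /\ x = ratio_of t.
Proof.
  intros Hx; exists (ratio_inv x); unfold ratio_inv, ratio_of.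
  pose proof (omega_gt1 x Hx); split; [lra|].
  assert (omega x * omega x = 8 * x + 1) by (apply sqrt_sqrt; lra); nra.
Qed.

Lemma sfun_ratio_of t : 0 < t -> sfun (ratio_of t) = / ratio_of (/ t).
Proof.
  intros Ht; unfold sfun; rewrite omega_ratio_of by easy; unfold ratio_of; field.
  lra.
Qed.

Lemma cfactor_ratio_of t : 0 < t -> cfactor (ratio_of t) = t * (2 + t).
Proof. intros Ht; unfold cfactor, cfun; rewrite omega_ratio_of by easy; field. Qed.

Lemma dfactor_ratio_of t : 0 < t -> dfactor (ratio_of t) = / (/ t * (2 + / t)).
Proof.
  intros Ht; unfold dfactor, dfun; rewrite omega_ratio_of by easy; field; lra.
Qed.

Lemma sfun_reversible x : 0 < x -> sfun (/ sfun x) = / x.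
Proof.
  intros Hx; destruct (ratio_of_surj x Hx) as (t & Ht & ->).
  pose proof (Rinv_0_lt_compat t Ht).
  now rewrite sfun_ratio_of, Rinv_inv, sfun_ratio_of, Rinv_inv.
Qed.

Lemma cfactor_dfactor_dual : dual sfun cfactor dfactor.
Proof.
  intros x Hx; destruct (ratio_of_surj x Hx) as (t & Ht & ->).
  pose proof (Rinv_0_lt_compat t Ht).
  rewrite sfun_ratio_of, Rinv_inv, cfactor_ratio_of, dfactor_ratio_of by easy.
  field; lra.
Qed.

Lemma sfun_contracting : contracting sfun.
Proof.
  exists (/ 9); split; [lra|]; intros x Hx.
  destruct (ratio_of_surj x Hx) as (t & Ht & ->).
  pose proof (ratio_of_pos _ (Rinv_0_lt_compat t Ht)) as Hr.
  rewrite sfun_ratio_of by easy; split; [now apply Rinv_0_lt_compat|].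
  apply Rmult_le_reg_r with (9 * ratio_of (/ t)); [lra|].
  replace (/ ratio_of (/ t) * (9 * ratio_of (/ t))) with 9 by (field; lra).
  replace (/ 9 * ratio_of t * (9 * ratio_of (/ t))) with (9 + 2 * (t - 1) ^ 2 / t)
    by (unfold ratio_of; field; lra).
  assert (0 <= 2 * (t - 1) ^ 2 / t); [|lra].
  apply Rdiv_le_0_compat; [pose proof (pow2_ge_0 (t - 1)); lra|easy].
Qed.

Lemma sfun_pos x : 0 < x -> 0 < sfun x.
Proof. now apply contracting_bounds, sfun_contracting. Qed.

Lemma Rinv_pos_le_contravar x y : 0 < x <= y -> 0 < / y <= / x.
Proof.
  intros H; split; [apply Rinv_0_lt_compat|apply Rinv_le_contravar]; lra.
Qed.

Lemma increasing_pos_of_ratio_of f :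
  (forall t t', 0 < t <= t' -> f (ratio_of t) <= f (ratio_of t')) -> increasing_pos f.
Proof.
  intros H x y Hxy; destruct (ratio_of_surj x ltac:(lra)) as (t & Ht & ->).
  destruct (ratio_of_surj y ltac:(lra)) as (t' & Ht' & ->).
  apply H; split; [easy|unfold ratio_of in Hxy; nra].
Qed.

Lemma sfun_increasing_pos : increasing_pos sfun.
Proof.
  apply increasing_pos_of_ratio_of; intros t t' Ht.
  pose proof (Rinv_pos_le_contravar t t' Ht).
  rewrite !sfun_ratio_of by lra; apply Rinv_pos_le_contravar; unfold ratio_of; nra.
Qed.

Lemma cfactor_increasing_pos : increasing_pos cfactor.
Proof.
  apply increasing_pos_of_ratio_of; intros t t' Ht.
  rewrite !cfactor_ratio_of by lra; nra.
Qed.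

Lemma dfactor_increasing_pos : increasing_pos dfactor.
Proof.
  apply increasing_pos_of_ratio_of; intros t t' Ht.
  pose proof (Rinv_pos_le_contravar t t' Ht).
  rewrite !dfactor_ratio_of by lra; apply Rinv_pos_le_contravar; nra.
Qed.

Lemma cfactor_pos x : 0 < x -> 0 < cfactor x.
Proof.
  intros Hx; destruct (ratio_of_surj x Hx) as (t & Ht & ->).
  rewrite cfactor_ratio_of by easy; nra.
Qed.

Lemma dfactor_pos x : 0 < x -> 0 < dfactor x.
Proof.
  intros Hx; destruct (ratio_of_surj x Hx) as (t & Ht & ->).
  rewrite dfactor_ratio_of by easy; pose proof (Rinv_0_lt_compat t Ht).
  apply Rinv_0_lt_compat; nra.
Qed.

Lemma sfun_cfactor x : 0 < x -> sfun x * cfactor x = x * dfactor x.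
Proof.
  intros Hx; destruct (ratio_of_surj x Hx) as (t & Ht & ->).
  rewrite sfun_ratio_of, cfactor_ratio_of, dfactor_ratio_of by easy.
  unfold ratio_of; field; lra.
Qed.

Lemma cfactor_weight : weight cfactor.
Proof.
  split; [exact cfactor_pos|]; intros X HX; exists (2 + X); split; [lra|].
  intros x Hx; destruct (ratio_of_surj x ltac:(lra)) as (t & Ht & ->).
  rewrite cfactor_ratio_of by easy; unfold ratio_of in *; nra.
Qed.

Lemma dfactor_le_cfactor x : 0 < x -> dfactor x <= cfactor x.
Proof.
  intros Hx; destruct (ratio_of_surj x Hx) as (t & Ht & ->).
  rewrite dfactor_ratio_of, cfactor_ratio_of by easy.
  replace (/ (/ t * (2 + / t))) with (t ^ 2 / (1 + 2 * t)) by (field; lra).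
  apply Rle_div_l; nra.
Qed.

Lemma dfactor_weight : weight dfactor.
Proof.
  split; [exact dfactor_pos|]; intros X HX.
  destruct (proj2 cfactor_weight X HX) as (C & HC & Hle); exists C; split; [easy|].
  intros x Hx; apply Rle_trans with (cfactor x); [|now apply Hle].
  now apply dfactor_le_cfactor.
Qed.

#[local] Hint Resolve Rinv_0_lt_compat sfun_pos cfactor_pos dfactor_pos sfun_contracting
  sfun_reversible cfactor_weight dfactor_weight cfactor_dfactor_dual : core.

Lemma dfactor_cfactor_dual : dual sfun dfactor cfactor.
Proof. apply dual_sym; auto. Qed.

#[local] Hint Resolve dfactor_cfactor_dual : core.

Lemma sfun_continuous_pos : continuous_pos sfun.
Proof.
  intros x Hx; apply derivable_continuous_pt, ex_derive_Reals_0; unfold sfun, omega.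
  pose proof (omega_gt1 x Hx) as Ho; unfold omega in Ho.
  auto_derive; repeat split; lra.
Qed.

Lemma cfactor_continuous_pos : continuous_pos cfactor.
Proof.
  intros x Hx; apply derivable_continuous_pt, ex_derive_Reals_0.
  unfold cfactor, cfun, omega; auto_derive; repeat split; lra.
Qed.

Lemma dfactor_continuous_pos : continuous_pos dfactor.
Proof.
  intros x Hx; apply derivable_continuous_pt, ex_derive_Reals_0.
  unfold dfactor, dfun, omega.
  pose proof (omega_gt1 x Hx) as Ho; unfold omega in Ho.
  auto_derive; repeat split; lra.
Qed.

(** * The margin as a function of the central ratio *)

Definition csum : R -> R := bisum sfun cfactor dfactor.
Definition dsum : R -> R := bisum sfun dfactor cfactor.
Definition margin (x : R) : R := x * dsum x / csum x.

Lemma csum_pos x : 0 < x -> 0 < csum x.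
Proof. apply bisum_pos; auto. Qed.

Lemma dsum_pos x : 0 < x -> 0 < dsum x.
Proof. apply bisum_pos; auto. Qed.

Lemma margin_pos x : 0 < x -> 0 < margin x.
Proof.
  intros Hx; apply Rdiv_lt_0_compat; [|now apply csum_pos].
  apply Rmult_lt_0_compat; [easy|now apply dsum_pos].
Qed.

Lemma margin_inv x : 0 < x -> margin (/ x) = / margin x.
Proof.
  intros Hx; unfold margin, csum, dsum; rewrite !bisum_inv.
  pose proof (csum_pos x Hx); pose proof (dsum_pos x Hx); unfold csum, dsum in *.
  field; lra.
Qed.

Lemma csum_sfun x : 0 < x -> csum (sfun x) = csum x / cfactor x.
Proof.
  intros Hx; pose proof (cfactor_pos x Hx); unfold csum.
  rewrite <- (bisum_step sfun) with (x := x) by auto; field; lra.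
Qed.

Lemma dsum_sfun x : 0 < x -> dsum (sfun x) = dsum x / dfactor x.
Proof.
  intros Hx; pose proof (dfactor_pos x Hx); unfold dsum.
  rewrite <- (bisum_step sfun) with (x := x) by auto; field; lra.
Qed.

Lemma margin_sfun x : 0 < x -> margin (sfun x) = margin x.
Proof.
  intros Hx; pose proof (cfactor_pos x Hx); pose proof (dfactor_pos x Hx).
  pose proof (csum_pos x Hx).
  unfold margin; rewrite csum_sfun, dsum_sfun by easy.
  replace (sfun x) with (x * dfactor x / cfactor x)
    by (rewrite <- sfun_cfactor by easy; field; lra).
  field; lra.
Qed.

Lemma margin_continuous_pos : continuous_pos margin.
Proof.
  pose proof sfun_continuous_pos; pose proof cfactor_continuous_pos.
  pose proof dfactor_continuous_pos; intros x Hx.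
  apply (continuity_pt_div (fun y => y * dsum y) csum).
  - apply (continuity_pt_mult (fun y => y) dsum).
    + apply derivable_continuous_pt, derivable_pt_id.
    + apply bisum_continuous_pos; auto.
  - apply bisum_continuous_pos; auto.
  - generalize (csum_pos x Hx); lra.
Qed.

(** * The range of the margin *)

Lemma margin_iter_sfun k x : 0 < x -> margin (Nat.iter k sfun x) = margin x.
Proof.
  intros Hx; induction k as [|k IH]; simpl; [easy|].
  now rewrite margin_sfun by now apply iter_contracting_pos.
Qed.

Lemma sfun_ratio_of_div t : 0 < t -> sfun (ratio_of t) = t ^ 2 / (2 + t).
Proof. intros Ht; rewrite sfun_ratio_of by easy; unfold ratio_of; field; lra. Qed.

Lemma sfun_1 : sfun 1 = / 10.
Proof.
  replace 1 with (ratio_of (/ 2)) by (unfold ratio_of; field).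
  rewrite sfun_ratio_of_div by lra; field.
Qed.

Lemma iter_sfun_reaches_fundamental_domain x :
  1 <= x -> exists k, / 10 <= Nat.iter k sfun x <= 1.
Proof.
  intros Hx; destruct sfun_contracting as (q & Hq & Hs).
  assert (Hreach : forall n z, 1 <= z -> q ^ n * z <= 1 ->
    exists k, / 10 <= Nat.iter k sfun z <= 1).
  { induction n as [|n IH]; intros z Hz Hzn; simpl in Hzn; [exists 0%nat; simpl; lra|].
    specialize (Hs z ltac:(lra)).
    pose proof (sfun_increasing_pos 1 z ltac:(lra)) as Hlow; rewrite sfun_1 in Hlow.
    destruct (Rle_dec (sfun z) 1) as [Hle|Hgt]; [exists 1%nat; simpl; lra|].
    destruct (IH (sfun z)) as [k Hk]; [lra| |].
    - pose proof (pow_lt q n ltac:(lra)); nra.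
    - exists (S k); now rewrite Nat.iter_succ_r. }
  destruct (pow_lt_1_zero q ltac:(rewrite Rabs_pos_eq; lra) (/ x)) as [n Hn];
    [apply Rinv_0_lt_compat; lra|].
  apply (Hreach n); [easy|]; specialize (Hn n (Nat.le_refl n)).
  apply Rabs_def2 in Hn; rewrite <- (Rinv_l x) by lra.
  apply Rmult_le_compat_r; lra.
Qed.

Lemma margin_fundamental_domain x :
  0 < x -> exists y, / 10 <= y <= 10 /\ margin y = margin x.
Proof.
  intros Hx.
  assert (Hge1 : forall z, 1 <= z -> exists y, / 10 <= y <= 1 /\ margin y = margin z).
  { intros z Hz; destruct (iter_sfun_reaches_fundamental_domain z Hz) as [k Hk].
    exists (Nat.iter k sfun z); split; [easy|apply margin_iter_sfun; lra]. }
  destruct (Rle_dec 1 x) as [H|H].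
  - destruct (Hge1 x H) as (y & Hy & Heq); exists y; split; [lra|easy].
  - assert (Hinv : 1 <= / x) by (rewrite <- Rinv_1; apply Rinv_le_contravar; lra).
    destruct (Hge1 (/ x) Hinv) as (y & Hy & Heq); exists (/ y); split.
    + rewrite <- (Rinv_inv 10); split; apply Rinv_le_contravar; lra.
    + rewrite margin_inv, Heq, margin_inv, Rinv_inv by lra; easy.
Qed.

Lemma margin_has_min :
  exists x0, 0 < x0 /\ forall x, 0 < x -> margin x0 <= margin x.
Proof.
  destruct (continuity_ab_min margin (/ 10) 10) as (x0 & Hmin & Hx0); [lra| |].
  { intros y Hy; apply margin_continuous_pos; lra. }
  exists x0; split; [lra|]; intros x Hx.
  destruct (margin_fundamental_domain x Hx) as (y & Hy & <-); now apply Hmin.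
Qed.

Lemma margin_intermediate x y :
  0 < x -> margin x <= y <= / margin x -> exists z, 0 < z /\ margin z = y.
Proof.
  (* [IVT_gen] requires continuity on the whole line. *)
  intros Hx Hy.
  assert (Hcont : continuity (fun z => margin (exp z))).
  { intros z; apply (continuity_pt_comp exp margin).
    - apply derivable_continuous_pt, derivable_pt_exp.
    - apply margin_continuous_pos, exp_pos. }
  destruct (IVT_gen _ (ln x) (- ln x) y Hcont) as (z & _ & Hz).
  - rewrite exp_Ropp, exp_ln, margin_inv by easy.
    pose proof (Rmin_l (margin x) (/ margin x)).
    pose proof (Rmax_r (margin x) (/ margin x)); lra.
  - exists (exp z); split; [apply exp_pos|easy].
Qed.

(** * A numerical upper bound for the least margin *)

(* The list bounds the successive [b_i / a_i] along the orbit of [x] from above (until an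
   iterate is at most [y]), respectively from below. *)
Fixpoint orbit_below (ts : list R) (x y : R) : Prop :=
  match ts with
  | [] => x <= y
  | t :: ts => 0 < t /\ x <= ratio_of t /\ orbit_below ts (t ^ 2 / (2 + t)) y
  end.

Fixpoint orbit_above (ts : list R) (x : R) : Prop :=
  match ts with
  | [] => True
  | t :: ts => 0 < t /\ ratio_of t <= x /\ orbit_above ts (t ^ 2 / (2 + t))
  end.

Fixpoint nested_sum (g : R -> R) (ts : list R) (K : R) : R :=
  match ts with
  | [] => K
  | t :: ts => g t * (1 + nested_sum g ts K)
  end.

Section NestedBounds.

Variables h g : R -> R.
Hypothesis h_weight : weight h.
Hypothesis h_increasing : increasing_pos h.
Hypothesis h_ratio_of : forall t, 0 < t -> h (ratio_of t) = g t.

Lemma orbit_sum_ratio_of t : 0 < t ->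
  orbit_sum sfun h (ratio_of t) = g t * (1 + orbit_sum sfun h (t ^ 2 / (2 + t))).
Proof.
  intros Ht; rewrite <- sfun_ratio_of_div, <- h_ratio_of by easy.
  now apply orbit_sum_rec; [..|apply ratio_of_pos].
Qed.

Lemma nested_sum_le_orbit_sum ts x :
  0 < x -> orbit_above ts x -> nested_sum g ts 0 <= orbit_sum sfun h x.
Proof.
  revert x; induction ts as [|t ts IH]; simpl; intros x Hx Hts.
  { now apply orbit_sum_ge0. }
  destruct Hts as (Ht & Htx & Hts).
  assert (Hq : 0 < t ^ 2 / (2 + t)) by (apply Rdiv_lt_0_compat; nra).
  apply Rle_trans with (orbit_sum sfun h (ratio_of t)).
  - rewrite orbit_sum_ratio_of by easy; apply Rmult_le_compat_l.
    + rewrite <- h_ratio_of by easy; now apply Rlt_le, h_weight, ratio_of_pos.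
    + specialize (IH _ Hq Hts); lra.
  - apply orbit_sum_increasing_pos; auto using sfun_increasing_pos, ratio_of_pos.
Qed.

Lemma orbit_sum_le_nested_sum ts x t K :
  0 < x -> orbit_below ts x (ratio_of t) -> 0 < t -> 0 <= K -> g t * (1 + K) <= K ->
  orbit_sum sfun h x <= nested_sum g ts K.
Proof.
  intros Hx Hts Ht HK HgK; revert x Hx Hts.
  pose proof (orbit_sum_increasing_pos sfun h sfun_contracting h_weight
                sfun_increasing_pos h_increasing) as Hmono.
  induction ts as [|u ts IH]; simpl; intros x Hx Hts.
  - apply Rle_trans with (orbit_sum sfun h (ratio_of t)); [now apply Hmono|].
    apply orbit_sum_le_of_supersolution; auto using sfun_increasing_pos, ratio_of_pos.
    now rewrite h_ratio_of.
  - destruct Hts as (Hu & Hxu & Hts).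
    assert (Hq : 0 < u ^ 2 / (2 + u)) by (apply Rdiv_lt_0_compat; nra).
    apply Rle_trans with (orbit_sum sfun h (ratio_of u)); [now apply Hmono|].
    rewrite orbit_sum_ratio_of by easy; apply Rmult_le_compat_l.
    + rewrite <- h_ratio_of by easy; now apply Rlt_le, h_weight, ratio_of_pos.
    + specialize (IH _ Hq Hts); lra.
Qed.

End NestedBounds.

(* The point [297 / 512 = ratio_of (11 / 32)] is close to the minimiser of [margin], whose
   minimum is about [0.9999032]; the lists are roundings to seven digits. *)
Lemma margin_le_near_min : margin (297 / 512) <= 999904 / 1000000.
Proof.
  pose (cgain := fun t : R => t * (2 + t)).
  pose (dgain := fun t : R => / (/ t * (2 + / t))).
  assert (dfactor_upper : orbit_sum sfun dfactor (297 / 512)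
    <= nested_sum dgain [11 / 32; 0.0461560; 0.0010391] 1).
  { apply (orbit_sum_le_nested_sum dfactor dgain) with (t := / 10);
      auto using dfactor_increasing_pos, dfactor_ratio_of;
      simpl; unfold ratio_of, dgain; repeat split; lra. }
  assert (cfactor_upper : orbit_sum sfun cfactor (/ (297 / 512))
    <= nested_sum cgain [0.7114848; 0.1447730; 0.0095884; 0.0000458] 1).
  { apply (orbit_sum_le_nested_sum cfactor cgain) with (t := / 10);
      auto using cfactor_increasing_pos, cfactor_ratio_of;
      simpl; unfold ratio_of, cgain; repeat split; lra. }
  assert (cfactor_lower : nested_sum cgain [11 / 32; 0.0461559; 0.0010389] 0
    <= orbit_sum sfun cfactor (297 / 512)).
  { apply nested_sum_le_orbit_sum;
      auto using cfactor_increasing_pos, cfactor_ratio_of;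
      simpl; unfold ratio_of; repeat split; lra. }
  assert (dfactor_lower : nested_sum dgain [0.7114847; 0.1447728; 0.0095883] 0
    <= orbit_sum sfun dfactor (/ (297 / 512))).
  { apply nested_sum_le_orbit_sum;
      auto using dfactor_increasing_pos, dfactor_ratio_of;
      simpl; unfold ratio_of; repeat split; lra. }
  apply Rle_div_l; [apply csum_pos; lra|]; unfold csum, dsum, bisum.
  simpl in *; unfold cgain, dgain in *; lra.
Qed.

Lemma margin_range : exists lam, 0 < lam <= 999904 / 1000000 /\
  forall y, (exists x, 0 < x /\ margin x = y) <-> lam <= y <= / lam.
Proof.
  destruct margin_has_min as (x0 & Hx0 & Hmin); pose proof (margin_pos x0 Hx0) as Hpos.
  exists (margin x0); split.
  - split; [easy|]; eapply Rle_trans; [|apply margin_le_near_min].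
    apply Hmin; lra.
  - intros y; split; [|now apply margin_intermediate].
    intros (x & Hx & <-); split; [now apply Hmin|].
    rewrite <- (Rinv_inv (margin x)), <- margin_inv by easy.
    apply Rinv_le_contravar; auto.
Qed.

(** * Increments of positive solutions *)

Definition incr (f : Z -> R) (i : Z) : R := f i - f (i - 1)%Z.
Definition decr (f : Z -> R) (i : Z) : R := f (i - 1)%Z - f i.

Lemma incr_succ f i : incr f (i + 1) = f (i + 1)%Z - f i.
Proof. unfold incr; do 2 f_equal; ring. Qed.

Lemma decr_succ f i : decr f (i + 1) = f i - f (i + 1)%Z.
Proof. unfold decr; do 2 f_equal; ring. Qed.

Lemma increments_of_balance A B u u' :
  0 < A -> 0 < B -> (A + B) * A = A * u' - B * u -> (A + B) ^ 2 = B * (u + u') ->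
  u = A ^ 2 / B /\ u' = 2 * A + B.
Proof.
  intros HA HB Hlin Hquad.
  assert (Hu : B * u = A ^ 2).
  { apply Rmult_eq_reg_l with (A + B); [|lra].
    assert (B * ((A + B) * A) = B * (A * u' - B * u)) by now rewrite Hlin.
    assert (A * (A + B) ^ 2 = A * (B * (u + u'))) by now rewrite Hquad.
    lra. }
  split; [rewrite <- Hu; field; lra|apply Rmult_eq_reg_l with B; lra].
Qed.

Lemma positive_ABMN_iff_increments a b m n :
  positive_ABMN a b m n <-> forall i,
    (0 < a i /\ 0 < b i) /\
    (incr m i = a i ^ 2 / b i /\ incr m (i + 1) = 2 * a i + b i) /\
    (decr n (i + 1) = b i ^ 2 / a i /\ decr n i = 2 * b i + a i).
Proof.
  split.
  - intros [H Hpos] i; destruct (H i) as (_ & _ & Em & En & Em2 & En2).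
    destruct (Hpos i) as [Ha Hb]; rewrite incr_succ, decr_succ; unfold incr, decr.
    split; [easy|split; apply increments_of_balance; lra].
  - intros H; split; intros i; [|apply H].
    destruct (H i) as ((Ha & Hb) & (Eu & Eu') & Ev' & Ev).
    rewrite incr_succ in Eu'; rewrite decr_succ in Ev'; unfold incr, decr in Eu, Ev.
    replace (m (i - 1)%Z) with (m i - a i ^ 2 / b i) by lra.
    replace (m (i + 1)%Z) with (m i + (2 * a i + b i)) by lra.
    replace (n (i - 1)%Z) with (n i + (2 * b i + a i)) by lra.
    replace (n (i + 1)%Z) with (n i - b i ^ 2 / a i) by lra.
    repeat split; try lra; field; lra.
Qed.

Lemma positive_ABMN_reflect a b m n : positive_ABMN a b m n ->
  positive_ABMN (fun i => b (-1 - i)%Z) (fun i => a (-1 - i)%Z)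
                (fun i => n (-1 - i)%Z) (fun i => m (-1 - i)%Z).
Proof.
  intros [H Hp]; split; intros i; [|split; apply Hp].
  destruct (H (-1 - i)%Z) as (Ha & Hb & Em & En & Em2 & En2).
  replace (-1 - i + 1)%Z with (-1 - (i - 1))%Z in * by ring.
  replace (-1 - i - 1)%Z with (-1 - (i + 1))%Z in * by ring.
  repeat split; lra.
Qed.

Lemma lim_minf_reflect (f : Z -> R) l :
  lim_pinf (fun i => f (-1 - i)%Z) l -> lim_minf f l.
Proof.
  intros H; apply is_lim_seq_Reals, is_lim_seq_incr_1; apply is_lim_seq_Reals in H.
  apply is_lim_seq_ext with (2 := H); intros k; f_equal; lia.
Qed.

Lemma lim_pinf_of_is_series (f : Z -> R) (q : nat -> R) A l :
  (forall k, incr f (Z.of_nat (S k)) = A * q k) -> is_series q l ->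
  lim_pinf f (f 0%Z + A * l).
Proof.
  intros Hf Hq; apply is_lim_seq_Reals, is_lim_seq_incr_1.
  apply is_lim_seq_ext with (fun k => f 0%Z + A * sum_n q k).
  - intros k; rewrite sum_n_Reals; induction k as [|k IH].
    + simpl sum_f_R0; rewrite <- Hf; unfold incr; simpl; ring.
    + rewrite tech5, Rmult_plus_distr_l, <- Hf, <- Rplus_assoc, IH; unfold incr.
      replace (Z.of_nat (S (S k)) - 1)%Z with (Z.of_nat (S k)) by lia; ring.
  - apply is_lim_seq_plus'; [apply is_lim_seq_const|].
    now apply (is_lim_seq_scal_l _ A l).
Qed.

Section PositiveSolution.

Variables a b m n : Z -> R.
Hypothesis abmn : positive_ABMN a b m n.

Lemma ABMN_increments_pos i : 0 < incr m i /\ 0 < decr n i.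
Proof.
  destruct (proj1 (positive_ABMN_iff_increments _ _ _ _) abmn i)
    as ((Ha & Hb) & (-> & _) & _ & ->).
  split; [apply Rdiv_lt_0_compat; nra|lra].
Qed.

Lemma ABMN_increments_succ i :
  decr n (i + 1) / incr m (i + 1) = sfun (decr n i / incr m i) /\
  incr m (i + 1) = incr m i * cfactor (decr n i / incr m i) /\
  decr n (i + 1) = decr n i * dfactor (decr n i / incr m i).
Proof.
  destruct (proj1 (positive_ABMN_iff_increments _ _ _ _) abmn i)
    as ((Ha & Hb) & (-> & ->) & -> & ->).
  assert (Ht : 0 < b i / a i) by now apply Rdiv_lt_0_compat.
  replace ((2 * b i + a i) / (a i ^ 2 / b i)) with (ratio_of (b i / a i))
    by (unfold ratio_of; field; lra).
  rewrite sfun_ratio_of, cfactor_ratio_of, dfactor_ratio_of by easy.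
  unfold ratio_of; repeat split; field; lra.
Qed.

Lemma central_ratio_pos : 0 < central_ratio m n.
Proof. apply Rdiv_lt_0_compat; apply (ABMN_increments_pos 0). Qed.

Lemma ABMN_increments_of_nat k :
  decr n (Z.of_nat k) / incr m (Z.of_nat k) = Nat.iter k sfun (central_ratio m n) /\
  incr m (Z.of_nat k) = incr m 0 * orbit_prod sfun cfactor (central_ratio m n) k /\
  decr n (Z.of_nat k) = decr n 0 * orbit_prod sfun dfactor (central_ratio m n) k.
Proof.
  induction k as [|k (Ex & Eu & Ev)].
  - unfold orbit_prod; simpl; repeat split; ring.
  - rewrite Nat2Z.inj_succ, <- Z.add_1_r.
    destruct (ABMN_increments_succ (Z.of_nat k)) as (-> & -> & ->); rewrite Ex, Eu, Ev.
    unfold orbit_prod; simpl; repeat split; ring.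
Qed.

Lemma ABMN_lim_pinf :
  lim_pinf m (m 0%Z + incr m 0 * orbit_sum sfun cfactor (central_ratio m n)) /\
  lim_pinf n (n 0%Z - decr n 0 * orbit_sum sfun dfactor (central_ratio m n)).
Proof.
  pose proof central_ratio_pos as Hx; unfold Rminus; rewrite Ropp_mult_distr_l.
  split.
  - apply lim_pinf_of_is_series with
      (fun k => orbit_prod sfun cfactor (central_ratio m n) (S k)).
    + intros k; apply ABMN_increments_of_nat.
    + now apply Series_correct, ex_series_orbit_prod.
  - apply lim_pinf_of_is_series with
      (fun k => orbit_prod sfun dfactor (central_ratio m n) (S k)).
    + intros k; destruct (ABMN_increments_of_nat (S k)) as (_ & _ & E).
      rewrite <- Ropp_mult_distr_l, <- E; unfold incr, decr; ring.
    + now apply Series_correct, ex_series_orbit_prod.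
Qed.

End PositiveSolution.

Lemma ABMN_lim_minf a b m n : positive_ABMN a b m n ->
  lim_minf m (m (-1)%Z - incr m 0 * orbit_sum sfun dfactor (/ central_ratio m n)) /\
  lim_minf n (n (-1)%Z + decr n 0 * orbit_sum sfun cfactor (/ central_ratio m n)).
Proof.
  intros H; destruct (ABMN_lim_pinf _ _ _ _ (positive_ABMN_reflect a b m n H)) as [Hn Hm].
  replace (central_ratio _ _) with (/ central_ratio m n) in Hn, Hm
    by (unfold central_ratio; simpl; apply Rinv_div).
  split; apply lim_minf_reflect; easy.
Qed.

Lemma mina_margin_central_ratio a b m n mmi mpi nmi npi : positive_ABMN a b m n ->
  lim_minf m mmi -> lim_pinf m mpi -> lim_minf n nmi -> lim_pinf n npi ->
  mina_margin mmi mpi nmi npi = margin (central_ratio m n).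
Proof.
  intros H Hmmi Hmpi Hnmi Hnpi; destruct (ABMN_lim_pinf a b m n H) as [Lmpi Lnpi].
  destruct (ABMN_lim_minf a b m n H) as [Lmmi Lnmi].
  rewrite (UL_sequence _ _ _ Hmmi Lmmi), (UL_sequence _ _ _ Hmpi Lmpi),
    (UL_sequence _ _ _ Hnmi Lnmi), (UL_sequence _ _ _ Hnpi Lnpi).
  destruct (ABMN_increments_pos a b m n H 0) as [Hu _].
  pose proof (csum_pos _ (central_ratio_pos a b m n H)) as Hc.
  assert (Hv : decr n 0 = central_ratio m n * incr m 0)
    by (unfold central_ratio, incr, decr in *; simpl in *; field; lra).
  set (x := central_ratio m n) in *; unfold mina_margin, margin.
  replace (m 0%Z + incr m 0 * orbit_sum sfun cfactor x
    - (m (-1)%Z - incr m 0 * orbit_sum sfun dfactor (/ x))) with (incr m 0 * csum x)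
    by (unfold csum, bisum, incr; simpl; ring).
  replace (n (-1)%Z + decr n 0 * orbit_sum sfun cfactor (/ x)
    - (n 0%Z - decr n 0 * orbit_sum sfun dfactor x)) with (decr n 0 * dsum x)
    by (unfold dsum, bisum, decr; simpl; ring).
  rewrite Hv; field; lra.
Qed.

(** * The bilateral orbit of the central ratio *)

Lemma s_Z_of_nat k x : s_Z (Z.of_nat k) x = Nat.iter k sfun x.
Proof.
  destruct k as [|k]; [easy|]; simpl s_Z; now rewrite SuccNat2Pos.id_succ.
Qed.

Lemma s_Z_opp_of_nat k x : s_Z (- Z.of_nat k) x = / Nat.iter k sfun (/ x).
Proof.
  destruct k as [|k]; [simpl; now rewrite Rinv_inv|]; simpl s_Z.
  rewrite SuccNat2Pos.id_succ; generalize (S k); clear k; intros k.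
  induction k as [|k IH]; simpl; [now rewrite Rinv_inv|].
  now rewrite IH; unfold sm1; rewrite Rinv_inv.
Qed.

Lemma Z_of_nat_or_opp_of_nat i :
  (exists k, i = Z.of_nat k) \/ exists k, i = (- Z.of_nat (S k))%Z.
Proof.
  destruct (Z_le_gt_dec 0 i).
  - left; exists (Z.to_nat i); lia.
  - right; exists (Z.to_nat (- i - 1)); lia.
Qed.

Lemma s_Z_pos i x : 0 < x -> 0 < s_Z i x.
Proof.
  intros Hx; destruct (Z_of_nat_or_opp_of_nat i) as [(k & ->)|(k & ->)].
  - rewrite s_Z_of_nat; now apply iter_contracting_pos.
  - rewrite s_Z_opp_of_nat; apply Rinv_0_lt_compat, iter_contracting_pos; auto.
Qed.

Lemma s_Z_succ i x : 0 < x -> s_Z (i + 1) x = sfun (s_Z i x).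
Proof.
  intros Hx; destruct (Z_of_nat_or_opp_of_nat i) as [(k & ->)|(k & ->)].
  - replace (Z.of_nat k + 1)%Z with (Z.of_nat (S k)) by lia; now rewrite !s_Z_of_nat.
  - replace (- Z.of_nat (S k) + 1)%Z with (- Z.of_nat k)%Z by lia.
    rewrite !s_Z_opp_of_nat; simpl; rewrite sfun_reversible; [easy|].
    apply iter_contracting_pos; auto.
Qed.

(* The reciprocals in the product convention for [k <= -2] turn the backward orbit
   of [x] into the forward orbit of [/ x], with [h] replaced by its dual. *)
Lemma zsum_bisum h h' x : weight h -> weight h' -> dual sfun h h' -> 0 < x ->
  zsum (fun k => zprod (fun i => h (s_Z i x)) k) (bisum sfun h h' x).
Proof.
  intros Hh Hh' Hdual Hx; exists (orbit_sum sfun h x), (1 + orbit_sum sfun h' (/ x)).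
  split; [|split; [|unfold bisum; ring]]; apply is_series_Reals.
  - eapply is_series_ext; [|now apply Series_correct, ex_series_orbit_prod].
    intros k; unfold zprod; rewrite (proj2 (Z.leb_le 0 _)) by lia.
    rewrite Nat2Z.id; apply prodn_ext; intros i; now rewrite s_Z_of_nat.
  - eapply is_series_ext; [|apply is_series_orbit_prod; auto].
    intros k; unfold zprod; rewrite (proj2 (Z.leb_gt 0 _)) by lia.
    replace (Z.to_nat (- (- Z.of_nat k - 1) - 1)) with k by lia.
    apply prodn_ext; intros i.
    replace (- Z.of_nat i - 1)%Z with (- Z.of_nat (S i))%Z by lia.
    rewrite s_Z_opp_of_nat; simpl; set (y := Nat.iter i sfun (/ x)).
    assert (Hy : 0 < y) by (apply iter_contracting_pos; auto).
    specialize (Hdual y Hy); pose proof (proj1 Hh (/ sfun y) ltac:(auto)).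
    apply Rmult_eq_reg_r with (h (/ sfun y)); [|lra].
    rewrite Hdual; field; lra.
Qed.

(** * The standard solution *)

(* The standard solution at [i] is a function of the ratio [x] at [i]: its increment
   [u_i = m_i - m_(i-1)] is [/ csum x], [m_i] is the sum of the [u_j] with [j <= i], and
   [n_i] is the sum of the [n_(j-1) - n_j = x_j u_j] with [j > i]. *)
Definition standard_a (x : R) : R := ratio_inv x / csum x.
Definition standard_b (x : R) : R := ratio_inv x ^ 2 / csum x.
Definition standard_m (x : R) : R := (1 + orbit_sum sfun dfactor (/ x)) / csum x.
Definition standard_n (x : R) : R := x * orbit_sum sfun dfactor x / csum x.

Lemma standard_m_sfun x :
  0 < x -> standard_m (sfun x) - standard_m x = / csum (sfun x).
Proof.
  intros Hx; pose proof (csum_pos x Hx); pose proof (cfactor_pos x Hx); unfold standard_m.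
  rewrite <- (orbit_sum_dual_step sfun) with (h := cfactor) (x := x) by auto.
  rewrite csum_sfun by easy; field; lra.
Qed.

Lemma standard_n_sfun x :
  0 < x -> standard_n x - standard_n (sfun x) = sfun x / csum (sfun x).
Proof.
  intros Hx; pose proof (csum_pos x Hx); pose proof (cfactor_pos x Hx).
  pose proof (dfactor_pos x Hx); unfold standard_n.
  rewrite (orbit_sum_rec sfun dfactor) with (x := x) by auto.
  rewrite csum_sfun by easy.
  replace (sfun x) with (x * dfactor x / cfactor x) at 2 4
    by (rewrite <- sfun_cfactor by easy; field; lra).
  field; lra.
Qed.

Section StandardSolution.

Variable x : R.
Hypothesis x_pos : 0 < x.

Let m (i : Z) : R := standard_m (s_Z i x).
Let n (i : Z) : R := standard_n (s_Z i x).

Lemma incr_standard_m i : incr m i = / csum (s_Z i x).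
Proof.
  replace i with (i - 1 + 1)%Z by ring; rewrite incr_succ; unfold m.
  rewrite s_Z_succ by easy; now apply standard_m_sfun, s_Z_pos.
Qed.

Lemma decr_standard_n i : decr n i = s_Z i x / csum (s_Z i x).
Proof.
  replace i with (i - 1 + 1)%Z by ring; rewrite decr_succ; unfold n.
  rewrite s_Z_succ by easy; now apply standard_n_sfun, s_Z_pos.
Qed.

Lemma standard_solution_positive :
  positive_ABMN (fun i => standard_a (s_Z i x)) (fun i => standard_b (s_Z i x)) m n.
Proof.
  apply positive_ABMN_iff_increments; intros i; unfold standard_a, standard_b.
  rewrite !incr_standard_m, !decr_standard_n, s_Z_succ by easy.
  pose proof (s_Z_pos i x x_pos) as Hpos; pose proof (csum_pos _ Hpos).
  rewrite csum_sfun by easy; generalize dependent (s_Z i x); intros y Hy Hc.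
  destruct (ratio_of_surj y Hy) as (t & Ht & ->).
  rewrite ratio_inv_ratio_of, sfun_ratio_of, cfactor_ratio_of by easy.
  generalize dependent (csum (ratio_of t)); intros C HC; unfold ratio_of.
  repeat split; try (apply Rdiv_lt_0_compat; [nra|easy]); field; lra.
Qed.

Lemma central_ratio_standard : central_ratio m n = x.
Proof.
  change (decr n 0 / incr m 0 = x); rewrite incr_standard_m, decr_standard_n; simpl.
  pose proof (csum_pos x x_pos); field; lra.
Qed.

Lemma standard_solution_limits :
  lim_minf m 0 /\ lim_pinf m 1 /\ lim_minf n (margin x) /\ lim_pinf n 0.
Proof.
  pose proof (csum_pos x x_pos) as Hc.
  destruct (ABMN_lim_pinf _ _ _ _ standard_solution_positive) as [Lmpi Lnpi].
  destruct (ABMN_lim_minf _ _ _ _ standard_solution_positive) as [Lmmi Lnmi].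
  pose proof (incr_standard_m 0) as Eu; pose proof (decr_standard_n 0) as Ev.
  simpl in Eu, Ev.
  assert (Em : m (-1)%Z = m 0%Z - / csum x) by (rewrite <- Eu; unfold incr; simpl; ring).
  assert (En : n (-1)%Z = n 0%Z + x / csum x) by (rewrite <- Ev; unfold decr; simpl; ring).
  rewrite central_ratio_standard, Eu in Lmpi, Lmmi.
  rewrite central_ratio_standard, Ev in Lnpi, Lnmi.
  rewrite Em in Lmmi; rewrite En in Lnmi.
  change (m 0%Z) with (standard_m x) in *; change (n 0%Z) with (standard_n x) in *.
  unfold standard_m in Lmpi, Lmmi; unfold standard_n in Lnpi, Lnmi.
  repeat split.
  - replace 0 with ((1 + orbit_sum sfun dfactor (/ x)) / csum x - / csum x
      - / csum x * orbit_sum sfun dfactor (/ x)) by (field; lra); easy.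
  - replace 1 with ((1 + orbit_sum sfun dfactor (/ x)) / csum x
      + / csum x * orbit_sum sfun cfactor x); [easy|].
    replace 1 with (csum x / csum x) at 2 by (field; lra).
    unfold csum at 3, bisum; field; lra.
  - replace (margin x) with (x * orbit_sum sfun dfactor x / csum x + x / csum x
      + x / csum x * orbit_sum sfun cfactor (/ x)); [easy|].
    unfold margin, dsum, bisum; field; lra.
  - replace 0 with (x * orbit_sum sfun dfactor x / csum x
      - x / csum x * orbit_sum sfun dfactor x) by (field; lra); easy.
Qed.

Lemma standard_exists : exists a b m n,
  standard a b m n /\ central_ratio m n = x /\ lim_minf n (margin x).
Proof.
  destruct standard_solution_limits as (Lmmi & Lmpi & Lnmi & Lnpi).
  exists (fun i => standard_a (s_Z i x)), (fun i => standard_b (s_Z i x)), m, n.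
  split; [|split; [exact central_ratio_standard|easy]].
  split; [exact standard_solution_positive|]; repeat split; try easy.
  now exists (margin x).
Qed.

End StandardSolution.

Lemma MinaMap_margin x : 0 < x -> MinaMap x = margin x.
Proof.
  intros Hx.
  assert (Hspec : exists a b m n,
    standard a b m n /\ central_ratio m n = x /\ lim_minf n (MinaMap x)).
  { apply (epsilon_spec (inhabits 0) (fun y => exists a b m n,
      standard a b m n /\ central_ratio m n = x /\ lim_minf n y)).
    exists (margin x); now apply standard_exists. }
  destruct Hspec as (a & b & m & n & (H & Hmmi & Hnpi & Hmpi & _) & <- & Hnmi).
  rewrite <- (mina_margin_central_ratio a b m n _ _ _ _ H Hmmi Hmpi Hnmi Hnpi).
  unfold mina_margin; field.
Qed.

Lemma MinaMap_continuous_pos : continuous_pos MinaMap.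
Proof.
  intros x Hx; apply continuity_pt_ext_loc with margin; [|now apply margin_continuous_pos].
  apply (locally_open (fun y => 0 < y)); [apply open_gt| |easy].
  intros y Hy; now rewrite MinaMap_margin.
Qed.

Lemma margins_of_positive_iff r :
  margins_of_positive r <-> exists x, 0 < x /\ margin x = r.
Proof.
  split.
  - intros (a & b & m & n & mmi & mpi & nmi & npi & H & Hm & Hm' & Hn & Hn' & ->).
    exists (central_ratio m n); split; [now apply (central_ratio_pos a b)|].
    symmetry; now apply (mina_margin_central_ratio a b).
  - intros (x & Hx & <-).
    destruct (standard_exists x Hx) as
      (a & b & m & n & (H & Hm & Hn & Hm' & _) & _ & Hn').
    exists a, b, m, n, 0, 1, (margin x), 0; repeat (split; [easy|]).
    unfold mina_margin; field.
Qed.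

Theorem mainTheorem14 :
  (forall x, 0 < x -> 0 < MinaMap x) /\
  (forall x, 0 < x -> MinaMap (sfun x) = MinaMap x) /\
  (forall x, 0 < x -> continuity_pt MinaMap x) /\
  (forall x, 0 < x ->
     exists Sc Sd,
       zsum (fun k => zprod (fun i => c_Z i x - 1) k) Sc /\
       zsum (fun k => zprod (fun i => d_Z i x - 1) k) Sd /\
       MinaMap x = / Sc * (x * Sd)) /\
  (exists lam, 0 < lam /\ lam <= 999904 / 1000000 /\
     is_inf margins_of_positive lam /\
     forall y, (exists x, 0 < x /\ MinaMap x = y) <-> (lam <= y <= / lam)).
Proof.
  split; [|split; [|split; [exact MinaMap_continuous_pos|split]]].
  - intros x Hx; rewrite MinaMap_margin by easy; now apply margin_pos.
  - intros x Hx; rewrite !MinaMap_margin by auto; now apply margin_sfun.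
  - intros x Hx; exists (csum x), (dsum x); split; [|split].
    + apply (zsum_bisum cfactor dfactor); auto.
    + apply (zsum_bisum dfactor cfactor); auto.
    + rewrite MinaMap_margin by easy; unfold margin, Rdiv; ring.
  - destruct margin_range as (lam & Hlam & Hrange); exists lam.
    split; [easy|split; [easy|split; [split|]]].
    + intros y Hy; now apply Hrange, margins_of_positive_iff.
    + intros l Hl; apply Hl, margins_of_positive_iff, Hrange; split; [lra|].
      apply Rle_trans with 1; [lra|rewrite <- Rinv_1; apply Rinv_le_contravar; lra].
    + intros y; rewrite <- Hrange.
      split; intros (x & Hx & <-); exists x; now rewrite MinaMap_margin.
Qed.
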